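(* Consider one color-filter-array (CFA) plane. Suppose that the true local noise variance at pixel $i$ is $a^\star x_i+b^\star$, whereas the generalized Anscombe transform is applied with parameters $(\bar a,\bar b)$. Then, to first order in the noise amplitude, $$\operatorname{Var}\left[T_{\bar a,\bar b}(y_i)\mid x_i\right]\approx\frac{a^\star x_i+b^\star}{\bar a x_i+\bar b+\frac38\bar a^2}.$$
   Context: Setting: a single color-filter-array plane of a RAW image. A normalized RAW pixel observation is $y_i=x_i+n_i$, where $x_i$ is the clean intensity and, conditionally on $x_i$, the noise $n_i$ is Gaussian with mean $0$ and signal-dependent variance (Poisson--Gaussian noise model); here the true variance is $a^\star x_i+b^\star$, with shot-noise parameter $a^\star>0$ and read-noise parameter $b^\star\ge 0$. The parameters $\bar a>0$, $\bar b\ge 0$ used in the transform may differ from $a^\star,b^\star$. For parameters $a>0$, $b\ge 0$, the generalized Anscombe transform is $$T_{a,b}(u)=\frac{2}{a}\sqrt{a u+\tfrac38 a^2+b}.$$ *)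

(* Defs.v *)
From HB Require Import structures.
From mathcomp Require Import all_boot all_order all_algebra.
From mathcomp Require Import all_classical all_reals all_analysis.
Set Implicit Arguments.
Unset Strict Implicit.
Unset Printing Implicit Defensive.
Import Order.TTheory GRing.Theory Num.Theory.
Import numFieldNormedType.Exports.
Local Open Scope classical_set_scope.
Local Open Scope ring_scope.

(* [Num.sqrt] is 0 on negative arguments, so the transform is clipped at 0
   where a * u + 3/8 * a^2 + b < 0; a Gaussian observation reaches that region
   with positive probability. *)
Definition gen_anscombe (R : realType) (a b u : R) : R :=
  2 / a * Num.sqrt (a * u + 3 / 8 * a ^+ 2 + b).

(* The library's [normal_prob m 0] is the uniform law on [0, 1]; the Gaussian
   law of variance 0 has to be the point mass at [m]. *)
Definition gaussian_law (R : realType) (m v : R) (B : set R) : \bar R :=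
  if v == 0 then \d_m B else normal_prob m (Num.sqrt v) B.

(* [k] is a regular conditional law of [Y] given [X]. *)
Definition is_cond_law (R : realType) (d : measure_display)
    (T : measurableType d) (P : probability T R) (X Y : T -> R)
    (k : R -> set R -> \bar R) : Prop :=
  forall A B : set R, measurable A -> measurable B ->
    P (X @^-1` A `&` Y @^-1` B) = (\int[P]_(w in X @^-1` A) k (X w) B)%E.

(* [m \o X] is a version of E[Z | X]; the events of sigma(X) are the
   X @^-1` A with A Borel. *)
Definition is_cond_expectation (R : realType) (d : measure_display)
    (T : measurableType d) (P : probability T R) (X Z : T -> R)
    (m : R -> R) : Prop :=
  [/\ measurable_fun [set: R] m,
      P.-integrable [set: T] (EFin \o Z),
      P.-integrable [set: T] (EFin \o (m \o X)) &
      forall A : set R, measurable A ->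
        (\int[P]_(w in X @^-1` A) (m (X w))%:E
         = \int[P]_(w in X @^-1` A) (Z w)%:E)%E].

(* [v \o X] is a version of Var[Z | X] = E[(Z - E[Z | X])^2 | X]. *)
Definition is_cond_variance (R : realType) (d : measure_display)
    (T : measurableType d) (P : probability T R) (X Z : T -> R)
    (v : R -> R) : Prop :=
  exists2 m : R -> R, is_cond_expectation P X Z m &
    is_cond_expectation P X (fun w => (Z w - m (X w)) ^+ 2) v.

(* Main.v *)
(* Conditionally on x_i = t the noise is distributed as sqrt(s) * Z with Z standard
   normal and s = a* t + b*, also when s = 0.  Hence the law of (x_i, n_i) is the
   image of law(x_i) (x) N(0,1) under (t, z) |-> (t, sqrt(s(t)) * z), and by Fubini
   any version of the conditional variance is a.e. the variance of T(t + sqrt(s) Z).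
   With D = abar t + bbar + 3/8 abar^2, the clipped square root satisfies globally
   |T(t + u) - T(t) - u / sqrt D| <= abar u^2 / D^(3/2), so that the variance differs
   from s / D by a relative error O(sqrt s); the constant is uniform in t >= 0
   because D >= 3/8 abar^2. *)
Require Import Defs.
From HB Require Import structures.
From mathcomp Require Import all_boot all_order all_algebra.
From mathcomp Require Import all_classical all_reals all_analysis.
From mathcomp Require Import measurable_realfun ring lra.
Set Implicit Arguments.
Unset Strict Implicit.
Unset Printing Implicit Defensive.
Import Order.TTheory GRing.Theory Num.Theory.
Import numFieldNormedType.Exports.
Local Open Scope classical_set_scope.
Local Open Scope ring_scope.

Local Notation N01 := (normal_prob 0 1).

(* The canonical measure structure on [pushforward] takes the proof of
   measurability as an argument that unification cannot find. *)
Local Notation pushforward_measure :=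
  measure_function_pushforward__canonical__measure_function_Measure.

(** * Moments of the standard normal law *)

(** The density and the Radon-Nikodym derivative of [normal_prob m s] have the same integral over
    every measurable set, so they agree almost everywhere. *)
Lemma ge0_integral_normal_prob (R : realType) (m s : R) (f : R -> \bar R) :
  (forall x, 0 <= f x)%E -> measurable_fun [set: R] f ->
  (\int[normal_prob m s]_x f x =
   \int[lebesgue_measure]_x (f x * (normal_pdf m s x)%:E))%E.
Proof.
move=> f0 mf.
have dom := normal_prob_dominates m s.
rewrite -(Radon_Nikodym_SigmaFinite.change_of_variables dom)//.
have mpdf : measurable_fun [set: R] (EFin \o normal_pdf m s).
  by apply/measurable_EFinP; exact: measurable_normal_pdf.
have ig := Radon_Nikodym_SigmaFinite.f_integrable dom.
apply: ae_eq_integral => //.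
- by apply: emeasurable_funM => //; exact: measurable_int ig.
- exact: emeasurable_funM.
- apply: ae_eqe_mul2l; apply: integral_ae_eq => //.
  by move=> E _ mE; rewrite -Radon_Nikodym_SigmaFinite.f_integral.
Qed.

Lemma normal_peakE (R : realType) (s : R) : 0 < s ->
  normal_peak s = s^-1 * normal_peak 1.
Proof.
move=> s0; rewrite /normal_peak -invfM expr1n mul1r.
by rewrite -mulrnAr sqrtrM ?sqr_ge0// sqrtr_sqr gtr0_norm.
Qed.

(* The densities of N(m, s^2) all integrate to 1.  Bounding the density ratio
   below by its tangent at u = 0 of exp u gives one linear inequality between the
   moments of N(0, 1) for each (m, s), and these determine the first two moments. *)
Definition normal_ratio (R : realType) (m s x : R) : R :=
  s^-1 * expR (x ^+ 2 / 2 - (x - m) ^+ 2 / (s ^+ 2 *+ 2)).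

Lemma normal_ratioE (R : realType) (m s x : R) : 0 < s ->
  normal_ratio m s x * normal_pdf 0 1 x = normal_pdf m s x.
Proof.
move=> s0; rewrite !normal_pdfE ?oner_neq0 ?gt_eqF// (normal_peakE s0).
rewrite /normal_ratio /normal_fun mulrACA -expRD; congr (_ * expR _).
by rewrite subr0 expr1n !mulNr; ring.
Qed.

Lemma measurable_normal_ratio (R : realType) (m s : R) :
  measurable_fun [set: R] (normal_ratio m s).
Proof.
apply: measurable_funM => //; apply: measurableT_comp => //.
apply: measurable_funB; apply: measurable_funM => //.
by apply: measurable_funX; exact: measurable_funB.
Qed.

Lemma integral_normal_ratio (R : realType) (m s : R) : 0 < s ->
  (\int[N01]_x (normal_ratio m s x)%:E = 1)%E.
Proof.
move=> s0; rewrite ge0_integral_normal_prob//.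
- under eq_integral do rewrite -EFinM normal_ratioE//.
  exact: integral_normal_pdf.
- by move=> x; rewrite lee_fin mulr_ge0 ?expR_ge0 ?invr_ge0 ?ltW.
- by apply/measurable_EFinP; exact: measurable_normal_ratio.
Qed.

Lemma integrable_normal_ratio (R : realType) (m s : R) : 0 < s ->
  N01.-integrable [set: R] (EFin \o normal_ratio m s).
Proof.
move=> s0; apply/integrableP; split.
  by apply/measurable_EFinP; exact: measurable_normal_ratio.
under eq_integral => x _.
  rewrite /= ger0_norm ?mulr_ge0 ?expR_ge0 ?invr_ge0 ?ltW//; over.
by rewrite integral_normal_ratio// ltry.
Qed.

Lemma integrable_normal_expr4 (R : realType) :
  N01.-integrable [set: R] (fun x => (x ^+ 4)%:E).
Proof.
(* x^4 <= 32 exp(x^2/4), which is a multiple of the density ratio of N(0, 2). *)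
have s20 : 0 < Num.sqrt 2 :> R by rewrite sqrtr_gt0.
have := integrableZl measurableT (32 * Num.sqrt 2) (integrable_normal_ratio 0 s20).
apply: le_integrable => //.
  by apply/measurable_EFinP; exact: measurable_funX.
move=> x _ /=; rewrite lee_fin /normal_ratio subr0 sqr_sqrtr//.
rewrite mulrA mulfK ?gt_eqF//.
have -> : x ^+ 2 / 2 - x ^+ 2 / (2 *+ 2) = x ^+ 2 / 4 :> R by field.
have u0 : 0 <= x ^+ 2 / 4 by rewrite mulr_ge0 ?sqr_ge0.
(* With u = x^2/4 this is 1 + u^2/2 <= exp u, hence x^4 = 16 u^2 <= 32 exp u. *)
have e2 := @expR_ge1Dxn R _ 1 u0.
rewrite ger0_norm ?exprn_even_ge0// ger0_norm ?mulr_ge0 ?expR_ge0//.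
move: e2; rewrite (_ : 2`!%:R = 2)//; nra.
Qed.

Lemma sqr_le1Dexpr4 (R : realType) (x : R) : x ^+ 2 <= 1 + x ^+ 4.
Proof.
have x4 : x ^+ 4 = x ^+ 2 ^+ 2 by rewrite -exprM.
by have := sqr_ge0 (x ^+ 2 - 1); have := sqr_ge0 x; rewrite x4; lra.
Qed.

Lemma normr_le1Dexpr4 (R : realType) (x : R) : `|x| <= 1 + x ^+ 4.
Proof.
have := sqr_le1Dexpr4 x; have := sqr_ge0 (`|x| - 1).
have : 0 <= x ^+ 4 by rewrite exprn_even_ge0.
by rewrite sqrrB1 real_normK ?num_real//; lra.
Qed.

(** The common domination criterion: up to a constant, 1 + x^4 dominates x, x^2 and, for a remainder
    r of quadratic size, also r, x r and r^2. *)
Lemma integrable_normal_quartic (R : realType) (c : R) (f : R -> R) :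
  measurable_fun [set: R] f -> (forall x, `|f x| <= c * (1 + x ^+ 4)) ->
  N01.-integrable [set: R] (EFin \o f).
Proof.
move=> mf fle.
have i1 : N01.-integrable [set: R] (cst 1%:E).
  by apply: finite_measure_integrable_cst.
have := integrableZl measurableT c (integrableD measurableT i1 (@integrable_normal_expr4 R)).
apply: le_integrable => //; first exact/measurable_EFinP.
move=> x _ /=; rewrite lee_fin; apply: (le_trans (fle x)).
exact: ler_norm.
Qed.

Lemma integrable_normal_id (R : realType) :
  N01.-integrable [set: R] (fun x => x%:E).
Proof.
by apply: (@integrable_normal_quartic R 1 id) => // x; rewrite mul1r normr_le1Dexpr4.
Qed.

Lemma integrable_normal_sqr (R : realType) :
  N01.-integrable [set: R] (fun x => (x ^+ 2)%:E).
Proof.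
apply: (@integrable_normal_quartic R 1 (fun x => x ^+ 2)).
  exact: measurable_funX.
by move=> x; rewrite ger0_norm ?sqr_ge0// mul1r sqr_le1Dexpr4.
Qed.

Lemma Rintegral_normal_quadratic (R : realType) (c a b : R) :
  \int[N01]_x (c + a * x + b * x ^+ 2) =
  c + a * \int[N01]_x x + b * \int[N01]_x (x ^+ 2).
Proof.
have ic : N01.-integrable [set: R] (EFin \o cst c).
  exact: finite_measure_integrable_cst.
have ia : N01.-integrable [set: R] (EFin \o (fun x => a * x)).
  exact: integrableZl (@integrable_normal_id R).
have ib : N01.-integrable [set: R] (EFin \o (fun x => b * x ^+ 2)).
  exact: integrableZl (@integrable_normal_sqr R).
rewrite RintegralD//; last exact: (integrableD measurableT ic ia).
rewrite RintegralD// RintegralZl//; last exact: integrable_normal_id.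
rewrite RintegralZl//; last exact: integrable_normal_sqr.
by rewrite Rintegral_cst// [X in fine X]probability_setT mulr1.
Qed.

(** The ratio integrates to the total mass of N(m, s^2), so each quadratic minorant of it constrains
    the first two moments. *)
Lemma normal_tangent (R : realType) (m s c a b : R) : 0 < s ->
  (forall x, c + a * x + b * x ^+ 2 <= normal_ratio m s x) ->
  c + a * \int[N01]_x x + b * \int[N01]_x (x ^+ 2) <= 1.
Proof.
move=> s0 le_ratio; rewrite -Rintegral_normal_quadratic.
rewrite [leRHS](_ : 1 = \int[N01]_x normal_ratio m s x); last first.
  by rewrite /Rintegral integral_normal_ratio.
apply: le_Rintegral => //; last exact: integrable_normal_ratio.
apply: (@integrable_normal_quartic R (`|c| + `|a| + `|b|)).
  apply: measurable_funD; last by apply: measurable_funM => //; exact: measurable_funX.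
  by apply: measurable_funD => //; exact: measurable_funM.
move=> x; rewrite (le_trans (ler_normD _ _))//.
rewrite (le_trans (lerD (ler_normD _ _) (lexx _)))// !normrM.
have h4 : 0 <= x ^+ 4 by exact: exprn_even_ge0.
rewrite !mulrDl !lerD ?ler_wpM2l ?normr_le1Dexpr4//.
  by rewrite ler_peMr// lerDl.
by rewrite -normrM ger0_norm ?sqr_ge0// sqr_le1Dexpr4.
Qed.

(** For s = 1 the exponent m x - m^2/2 is affine in x, which gives m E <= m^2/2 for all m of either
    sign; m = E then forces E = 0. *)
Lemma normal_mean0 (R : realType) : \int[N01]_x x = 0 :> R.
Proof.
set E := Rintegral _ _ _.
have tangent m : m * E <= m ^+ 2 / 2.
  have : 1 - m ^+ 2 / 2 + m * E + 0 * \int[N01]_x (x ^+ 2) <= 1.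
    apply: (@normal_tangent R m 1) => // x; rewrite /normal_ratio invr1 mul1r.
    by apply: le_trans (expR_ge1Dx _); rewrite le_eqVlt; apply/orP; left;
      apply/eqP; field.
  lra.
have [E0|E0|//] := ltgtP E 0.
- by have := tangent E; nra.
- by have := tangent E; nra.
Qed.

(** For m = 0 the exponent is a multiple of x^2. The resulting inequality has a factor r - 1 that
    changes sign at r = 1, where the other factor is 2 - 2M; this leaves only M = 1. *)
Lemma normal_second_moment (R : realType) :
  \int[N01]_x (x ^+ 2) = 1 :> R.
Proof.
set M := Rintegral _ _ _.
have tangent r : 0 < r -> 0 <= (r - 1) * (2 * r ^+ 2 - M * (1 + r)).
  move=> r0.
  have : r^-1 + 0 * \int[N01]_x x + r^-1 * ((1 - r ^- 2) / 2) * M <= 1.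
    apply: (@normal_tangent R 0 r) => // x; rewrite /normal_ratio.
    rewrite mul0r addr0 -[X in X + _]mulr1 -mulrA -mulrDr ler_pM2l ?invr_gt0//.
    apply: le_trans (expR_ge1Dx _); rewrite le_eqVlt; apply/orP; left.
    by apply/eqP; field; rewrite gt_eqF.
  rewrite mul0r addr0 => h.
  (* Multiplying by 2 r^3 clears the denominators and exposes the factor r - 1. *)
  have r3 : 0 < 2 * r ^+ 3 by rewrite mulr_gt0// exprn_gt0.
  move: h; rewrite -subr_ge0 -(pmulr_rge0 _ r3); congr (0 <= _).
  by field; rewrite gt_eqF.
have M0 : 0 <= M by apply: Rintegral_ge0 => x _; exact: sqr_ge0.
(* At r = (1 + M)/2 the second factor equals (1 - M)/2, while r - 1 has the
   opposite sign. *)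
have [M1|M1|//] := ltgtP M 1.
- by have := tangent ((1 + M) / 2) ltac:(lra); nra.
- by have := tangent ((1 + M) / 2) ltac:(lra); nra.
Qed.

(** * Variance of an affine function of a Gaussian plus a quadratic remainder *)

(** The variance of G is al^2 + 2 al E[x r] + Var r. With K = E[1 + x^4], the cross term is at most
    2 al be K, and Var r <= E[r^2] <= be^2 K. *)
Lemma normal_variance_perturbation (R : realType) (c al be : R) (r G : R -> R) :
  0 <= al -> 0 <= be -> measurable_fun [set: R] r ->
  (forall x, `|r x| <= be * x ^+ 2) ->
  (forall x, G x = c + al * x + r x) ->
  `| \int[N01]_x (G x - \int[N01]_z G z) ^+ 2 - al ^+ 2 |
  <= (2 * al * be + be ^+ 2) * \int[N01]_x (1 + x ^+ 4).
Proof.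
move=> al0 be0 mr rle GE.
have Ifin (f : R -> R) (k : R) : measurable_fun [set: R] f ->
    (forall x, `|f x| <= k * (1 + x ^+ 4)) ->
    N01.-integrable [set: R] (EFin \o f) by exact: integrable_normal_quartic.
have ID (f g : R -> R) : N01.-integrable [set: R] (EFin \o f) ->
    N01.-integrable [set: R] (EFin \o g) ->
    N01.-integrable [set: R] (EFin \o (fun x => f x + g x)).
  by move=> If Ig; exact: (integrableD measurableT If Ig).
have IZ (f : R -> R) (k : R) : N01.-integrable [set: R] (EFin \o f) ->
    N01.-integrable [set: R] (EFin \o (fun x => k * f x)).
  by move=> If; exact: (integrableZl measurableT k If).
have Ic (k : R) : N01.-integrable [set: R] (EFin \o cst k).
  exact: finite_measure_integrable_cst.
have Ix : N01.-integrable [set: R] (EFin \o (fun x : R => x)) by exact: integrable_normal_id.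
have Ix2 : N01.-integrable [set: R] (EFin \o (fun x => x ^+ 2)).
  exact: integrable_normal_sqr.
have x4ge0 (x : R) : 0 <= x ^+ 4 by exact: exprn_even_ge0.
(* Expanding (|x| - 1)^2 x^2 >= 0 gives 2 |x|^3 <= x^4 + x^2. *)
have x3le (x : R) : `|x| * x ^+ 2 <= 1 + x ^+ 4.
  have x4 : x ^+ 4 = x ^+ 2 ^+ 2 by rewrite -exprM.
  have := sqr_le1Dexpr4 x; have := mulr_ge0 (sqr_ge0 (`|x| - 1)) (sqr_ge0 x).
  by have := sqr_ge0 (x ^+ 2); rewrite sqrrB1 real_normK ?num_real// x4; lra.
have I4 : N01.-integrable [set: R] (EFin \o (fun x => 1 + x ^+ 4)).
  by apply: ID; [exact: Ic|exact: integrable_normal_expr4].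
have Ir : N01.-integrable [set: R] (EFin \o r).
  apply: (Ifin r be) => // x; apply: (le_trans (rle x)).
  by rewrite ler_wpM2l// sqr_le1Dexpr4.
have r2le x : r x ^+ 2 <= be ^+ 2 * (1 + x ^+ 4).
  rewrite -(real_normK (num_real (r x))).
  have -> : be ^+ 2 * (1 + x ^+ 4) = be ^+ 2 + (be * x ^+ 2) ^+ 2 by ring.
  apply: (@le_trans _ _ ((be * x ^+ 2) ^+ 2)); last by rewrite lerDr sqr_ge0.
  by apply: lerXn2r (rle x); rewrite nnegrE // (mulr_ge0 be0 (sqr_ge0 x)).
have Ir2 : N01.-integrable [set: R] (EFin \o (fun x => r x ^+ 2)).
  apply: (Ifin _ (be ^+ 2)); first exact: measurable_funX.
  by move=> x; rewrite ger0_norm ?sqr_ge0.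
have xrle x : `|x * r x| <= be * (1 + x ^+ 4).
  rewrite normrM (le_trans (ler_wpM2l _ (rle x)))// mulrCA ler_wpM2l//.
have Ixr : N01.-integrable [set: R] (EFin \o (fun x => x * r x)).
  by apply: (Ifin _ be) => //; exact: measurable_funM.
pose rho := \int[N01]_x r x.
have EG : \int[N01]_z G z = c + rho.
  transitivity (\int[N01]_x (c + al * x + r x)).
    by apply: eq_Rintegral => x _.
  rewrite (RintegralD measurableT (ID _ _ (Ic c) (IZ _ al Ix)) Ir).
  rewrite (RintegralD measurableT (Ic c) (IZ _ al Ix)).
  rewrite (RintegralZl _ measurableT Ix) normal_mean0 mulr0 addr0 Rintegral_cst//.
  by rewrite [X in fine X]probability_setT mulr1.
rewrite EG.
pose A := \int[N01]_x (x * r x).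
pose B := \int[N01]_x (r x ^+ 2).
have -> : \int[N01]_x (G x - (c + rho)) ^+ 2 =
    al ^+ 2 + 2 * al * A + (B - rho ^+ 2).
  transitivity (\int[N01]_x (al ^+ 2 * x ^+ 2 + 2 * al * (x * r x) +
     (- (2 * al * rho)) * x + r x ^+ 2 + (- (2 * rho)) * r x + rho ^+ 2)).
    by apply: eq_Rintegral => x _; rewrite GE; ring.
  (* [i1] to [i5] are the integrability of the successive partial sums, from which the last summand
     is then split off repeatedly. *)
  have i1 := IZ _ (al ^+ 2) Ix2.
  have i2 := ID _ _ i1 (IZ _ (2 * al) Ixr).
  have i3 := ID _ _ i2 (IZ _ (- (2 * al * rho)) Ix).
  have i4 := ID _ _ i3 Ir2.
  have i5 := ID _ _ i4 (IZ _ (- (2 * rho)) Ir).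
  rewrite (RintegralD measurableT i5 (Ic _)).
  rewrite (RintegralD measurableT i4 (IZ _ _ Ir)).
  rewrite (RintegralD measurableT i3 Ir2).
  rewrite (RintegralD measurableT i2 (IZ _ _ Ix)).
  rewrite (RintegralD measurableT i1 (IZ _ _ Ixr)).
  rewrite (RintegralZl _ measurableT Ix2) (RintegralZl _ measurableT Ixr).
  rewrite (RintegralZl _ measurableT Ix) (RintegralZl _ measurableT Ir).
  rewrite [X in al ^+ 2 * X](@normal_second_moment R).
  rewrite normal_mean0.
  rewrite Rintegral_cst// [X in fine X]probability_setT.
  transitivity (al ^+ 2 * 1 + 2 * al * A + - (2 * al * rho) * 0 + B +
    - (2 * rho) * rho + rho ^+ 2 * 1) => //; ring.
set K := Rintegral _ _ _.
(* This is Var r; its sign is what allows its absolute value to be bounded by B alone. *)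
have var_ge0 : 0 <= B - rho ^+ 2.
  have : 0 <= \int[N01]_x (r x - rho) ^+ 2.
    by apply: Rintegral_ge0 => x _; exact: sqr_ge0.
  rewrite (_ : Rintegral _ _ _ = B - rho ^+ 2)//.
  transitivity (\int[N01]_x (r x ^+ 2 + (- (2 * rho)) * r x + rho ^+ 2)).
    by apply: eq_Rintegral => x _; ring.
  rewrite (RintegralD measurableT (ID _ _ Ir2 (IZ _ _ Ir)) (Ic _)).
  rewrite (RintegralD measurableT Ir2 (IZ _ _ Ir)) (RintegralZl _ measurableT Ir).
  rewrite Rintegral_cst// [X in fine X]probability_setT.
  transitivity (B + - (2 * rho) * rho + rho ^+ 2 * 1) => //; ring.
have r2K : B <= be ^+ 2 * K.
  by rewrite -(RintegralZl _ measurableT I4); apply: le_Rintegral => //; exact: IZ.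
have xrK : `|A| <= be * K.
  apply: (le_trans (le_normr_Rintegral measurableT Ixr)).
  rewrite -(RintegralZl _ measurableT I4); apply: le_Rintegral => //.
    exact: integrable_norm Ixr.
  exact: IZ.
have -> : al ^+ 2 + 2 * al * A + (B - rho ^+ 2) - al ^+ 2 =
    2 * al * A + (B - rho ^+ 2) by ring.
rewrite [leRHS]mulrDl.
apply: (le_trans (ler_normD _ _)); apply: lerD.
  by rewrite normrM ger0_norm ?mulr_ge0// -mulrA ler_wpM2l// mulr_ge0.
by rewrite ger0_norm// (le_trans _ r2K)// gerBl sqr_ge0.
Qed.

(** * First-order expansion of the clipped transform *)

(** Put q = sqrt D and p = sqrt (D + h). Without clipping the error is exactly -(p - q)^2 / (2 q),
    and h = (p - q)(p + q) with p + q >= q bounds (p - q)^2 q^2 by h^2. *)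
Lemma sqrt_first_order_error (R : realType) (D h : R) : 0 < D ->
  `|Num.sqrt (D + h) - Num.sqrt D - h / (2 * Num.sqrt D)|
  <= h ^+ 2 / (2 * (D * Num.sqrt D)).
Proof.
move=> D0.
have q0 : 0 < Num.sqrt D by rewrite sqrtr_gt0.
have qD : D = Num.sqrt D ^+ 2 by rewrite sqr_sqrtr// ltW.
set q := Num.sqrt D in q0 qD *; rewrite qD.
have q20 : 0 < q ^+ 2 by rewrite exprn_gt0.
have [Dh|Dh] := lerP 0 (q ^+ 2 + h).
  have p0 := sqrtr_ge0 (q ^+ 2 + h).
  have pD := sqr_sqrtr Dh.
  set p := Num.sqrt (q ^+ 2 + h) in p0 pD *.
  have -> : h = p ^+ 2 - q ^+ 2 by lra.
  have -> : p - q - (p ^+ 2 - q ^+ 2) / (2 * q) = - ((p - q) ^+ 2 / (2 * q)).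
    by field; rewrite gt_eqF.
  rewrite normrN ger0_norm; last by rewrite divr_ge0 ?sqr_ge0// mulr_ge0// ltW.
  have -> : (p - q) ^+ 2 / (2 * q) =
      (p - q) ^+ 2 * q ^+ 2 / (2 * (q ^+ 2 * q)) by field; rewrite gt_eqF.
  rewrite ler_pM2r; last by rewrite invr_gt0 !mulr_gt0.
  rewrite subr_sqr exprMn ler_wpM2l ?sqr_ge0//.
  by rewrite lerXn2r ?nnegrE ?lerDr ?addr_ge0// ltW.
(* Clipped case: the root is 0 and the error is linear in h. With Q = q^2 the claim becomes |2 Q +
   h| Q <= h^2, which holds because h < -Q. *)
rewrite ltr0_sqrtr// sub0r.
have -> : - q - h / (2 * q) = - ((2 * q ^+ 2 + h) * q ^+ 2 / (2 * (q ^+ 2 * q))).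
  by field; rewrite gt_eqF.
have den0 : 0 < 2 * (q ^+ 2 * q) by rewrite !mulr_gt0.
rewrite normrN normrM [X in _ * X]gtr0_norm ?invr_gt0// ler_pM2r ?invr_gt0//.
rewrite normrM (gtr0_norm q20); move: (q ^+ 2) q20 Dh => Q Q0 Dh.
by have [Qh|Qh] := ger0P (2 * Q + h); nra.
Qed.

(** Take h = a z in the square-root bound and multiply by 2 / a: the slope becomes 1 / sqrt D. *)
Lemma gen_anscombe_first_order_error (R : realType) (a b t z : R) :
  let D := a * t + b + 3 / 8 * a ^+ 2 in
  0 < a -> 0 < D ->
  `|gen_anscombe a b (t + z) - gen_anscombe a b t - z / Num.sqrt D|
  <= a / (D * Num.sqrt D) * z ^+ 2.
Proof.
move=> D a0 D0; have q0 : 0 < Num.sqrt D by rewrite sqrtr_gt0.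
have := sqrt_first_order_error (a * z) D0.
rewrite /gen_anscombe (_ : a * (t + z) + _ + b = D + a * z); last by rewrite /D; ring.
rewrite (_ : a * t + _ + b = D); last by rewrite /D; ring.
have a20 : 0 < 2 / a by rewrite divr_gt0.
rewrite -(ler_pM2l a20) => h.
have -> : 2 / a * Num.sqrt (D + a * z) - 2 / a * Num.sqrt D - z / Num.sqrt D =
   2 / a * (Num.sqrt (D + a * z) - Num.sqrt D - a * z / (2 * Num.sqrt D)).
  by field; rewrite !gt_eqF.
rewrite normrM (gtr0_norm a20) (le_trans h)// le_eqVlt; apply/orP; left.
by apply/eqP; field; rewrite !gt_eqF.
Qed.

Lemma measurable_gen_anscombe (R : realType) (a b : R) :
  measurable_fun [set: R] (gen_anscombe a b).
Proof.
apply: measurable_funM => //; apply: measurableT_comp.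
  by apply: continuous_measurable_fun; exact: sqrt_continuous.
by do 2![apply: measurable_funD => //]; exact: measurable_funM.
Qed.

(** * Uniform variance estimate for a Gaussian input *)

Lemma gen_anscombe_gaussian_variance (R : realType) (a b delta : R) :
  0 < a -> 0 <= b -> 0 < delta ->
  exists2 sigma0 : R, 0 < sigma0 &
  forall t s : R, 0 <= t -> 0 <= s -> Num.sqrt s <= sigma0 ->
    `|\int[N01]_z (gen_anscombe a b (t + Num.sqrt s * z)
          - \int[N01]_u gen_anscombe a b (t + Num.sqrt s * u)) ^+ 2
      - s / (a * t + b + 3 / 8 * a ^+ 2)|
    <= delta * (s / (a * t + b + 3 / 8 * a ^+ 2)).
Proof.
move=> a0 b0 delta0.
set K := \int[N01]_(z in [set: R]) (1 + z ^+ 4).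
have K0 : 0 <= K.
  by apply: Rintegral_ge0 => x _; rewrite addr_ge0// exprn_even_ge0.
(* Q bounds a / D for every t >= 0, because D >= 3/8 a^2; this makes the constant C independent of
   t. *)
pose Q := 8 / (3 * a).
have Q0 : 0 <= Q by rewrite divr_ge0// mulr_ge0// ltW.
pose C := (2 * Q + Q ^+ 2) * K.
have C0 : 0 <= C by rewrite mulr_ge0// addr_ge0 ?sqr_ge0// mulr_ge0.
have C10 : 0 < C + 1 by rewrite ltr_wpDl.
(* The bound 1 on g = sqrt s gives g^2 <= g, so the relative error is at most C g; the other bound
   makes C g <= delta, with C + 1 keeping the denominator positive. *)
exists (Num.min 1 (delta / (C + 1))); first by rewrite lt_min ltr01 divr_gt0.
move=> t s t0 s0; rewrite le_min => /andP[sqrts1 sqrtsd].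
pose T z := gen_anscombe a b (t + Num.sqrt s * z).
pose D := a * t + b + 3 / 8 * a ^+ 2.
rewrite -/D -[X in (X - _)]/(\int[N01]_z (T z - \int[N01]_u T u) ^+ 2).
have a20 : 0 < 3 / 8 * a ^+ 2 by rewrite mulr_gt0 ?exprn_gt0.
have Dge : 3 / 8 * a ^+ 2 <= D by rewrite /D lerDr addr_ge0// mulr_ge0// ltW.
have D0 : 0 < D by exact: lt_le_trans Dge.
have q0 : 0 < Num.sqrt D by rewrite sqrtr_gt0.
have qD : Num.sqrt D ^+ 2 = D by rewrite sqr_sqrtr// ltW.
set g := Num.sqrt s in sqrts1 sqrtsd T *.
have g0 : 0 <= g by exact: sqrtr_ge0.
have gs : s = g ^+ 2 by rewrite sqr_sqrtr.
pose al := g / Num.sqrt D.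
pose be := a / (D * Num.sqrt D) * s.
have al0 : 0 <= al by rewrite divr_ge0// ltW.
have be0 : 0 <= be by rewrite mulr_ge0// divr_ge0 ?mulr_ge0 ?ltW.
pose r z := T z - gen_anscombe a b t - al * z.
have mT : measurable_fun [set: R] T.
  apply: measurableT_comp; first exact: measurable_gen_anscombe.
  by apply: measurable_funD => //; exact: measurable_funM.
have mr : measurable_fun [set: R] r.
  by apply: measurable_funB; [exact: measurable_funB|exact: measurable_funM].
have rle z : `|r z| <= be * z ^+ 2.
  have := @gen_anscombe_first_order_error R a b t (g * z) a0 D0.
  rewrite -/D /r /T /al /be (_ : g * z / _ = g / Num.sqrt D * z); last by ring.
  by rewrite exprMn -gs mulrA.
have TE z : T z = gen_anscombe a b t + al * z + r z by rewrite /r; ring.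
have := normal_variance_perturbation al0 be0 mr rle TE.
rewrite -/K (_ : al ^+ 2 = s / D); last by rewrite /al expr_div_n qD gs.
move=> /le_trans; apply.
(* Factoring out the target value s / D turns the absolute error into a relative one that vanishes
   with g. *)
have -> : 2 * al * be + be ^+ 2 = s / D * (2 * (a / D) * g + (a / D) ^+ 2 * g ^+ 2).
  rewrite /al /be; set q := Num.sqrt D in q0 qD *.
  by rewrite -qD gs; field; rewrite gt_eqF.
have kQ : a / D <= Q.
  rewrite ler_pdivrMr// /Q.
  apply: (@le_trans _ _ (8 / (3 * a) * (3 / 8 * a ^+ 2))); last by rewrite ler_wpM2l.
  by rewrite le_eqVlt; apply/orP; left; apply/eqP; field; rewrite gt_eqF.
have k0 : 0 <= a / D by rewrite divr_ge0// ltW.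
rewrite -mulrA [leRHS]mulrC; apply: ler_wpM2l; first by rewrite divr_ge0// ltW.
apply: (@le_trans _ _ (C * g)).
  rewrite /C [leRHS]mulrAC ler_wpM2r//; move: (a / D) kQ k0 => k kQ k0.
  rewrite [leRHS]mulrDl lerD//; first by rewrite ler_wpM2r// ler_wpM2l.
  rewrite ler_pM ?sqr_ge0//; last by rewrite expr2 ler_piMl.
  by rewrite lerXn2r ?nnegrE.
apply: (@le_trans _ _ (C * (delta / (C + 1)))); first by rewrite ler_wpM2l.
rewrite mulrCA ler_piMr ?(ltW delta0)// ler_pdivrMr// mul1r lerDl//.
Qed.

(** * Centred Gaussian laws as dilations of N(0, 1) *)

Definition dilation (R : realType) (s : R) (z : measurableTypeR R) :
  measurableTypeR R := s * z.

Lemma measurable_dilation (R : realType) (s : R) :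
  measurable_fun [set: measurableTypeR R] (dilation s).
Proof. exact: measurable_funM. Qed.

(** By uniqueness of Lebesgue measure it suffices to compare on intervals ]a, b], whose preimage
    ]a/s, b/s] is shorter by the factor s. *)
Lemma lebesgue_measure_dilation (R : realType) (s : R) (A : set R) :
  0 < s -> measurable A ->
  lebesgue_measure A = (s%:E * lebesgue_measure (dilation s @^-1` A))%E.
Proof.
move=> s0.
have md := @measurable_dilation R s.
pose m : {measure set (measurableTypeR R) -> \bar R} :=
  mscale (NngNum (ltW s0)) (pushforward_measure lebesgue_measure md).
apply: (@lebesgue_measure_unique R m) => _ [[a b]] _ <-.
pose I : set R := `]a / s, b / s]%classic.
transitivity (s%:E * lebesgue_measure I)%E; last first.
  congr (_ * lebesgue_measure _)%E.
  apply/seteqP; split => z; rewrite /I /dilation/= !in_itv/= ltr_pdivrMr// ler_pdivlMr//;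
  by rewrite [s * z]mulrC.
rewrite /I !lebesgue_measure_itv/= !lte_fin ltr_pM2r ?invr_gt0//.
case: ifPn => _; last by rewrite mule0.
by rewrite -!EFinB -EFinM -mulrBl mulrC divfK// gt_eqF.
Qed.

(** For v = 0 the map is constantly 0, so the preimage is everything or empty, as for the point mass
    at 0. For v > 0, substitute x = s z: the Jacobian s cancels the factor 1/s in the peak of the
    density. *)
Lemma gaussian_law_dilation (R : realType) (v : R) (B : set R) :
  0 <= v -> measurable B ->
  gaussian_law 0 v B = N01 ((fun z => Num.sqrt v * z) @^-1` B).
Proof.
rewrite -[_ @^-1` B]/(dilation (Num.sqrt v) @^-1` B) /gaussian_law le_eqVlt.
move=> /predU1P[<- mB|v0 mB].
  rewrite eqxx sqrtr0 diracE.
  have [B0|B0] := boolP (0 \in B).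
    rewrite (_ : _ @^-1` _ = setT); first by rewrite [RHS]probability_setT.
    by apply/seteqP; split => // z _ /=; rewrite /dilation mul0r -inE.
  rewrite (_ : _ @^-1` _ = set0); first by rewrite [RHS]measure0.
  by apply/seteqP; split => // z /=; rewrite /dilation mul0r -inE (negbTE B0).
rewrite gt_eqF//; set s := Num.sqrt v.
have s0 : 0 < s by rewrite sqrtr_gt0.
rewrite /normal_prob.
have md := @measurable_dilation R s.
rewrite (@eq_measure_integral _ _ _ _ (mscale (NngNum (ltW s0))
   (pushforward_measure lebesgue_measure md))); last first.
  by move=> A mA _; exact: lebesgue_measure_dilation.
have mpdf : measurable_fun [set: R] (EFin \o normal_pdf 0 s).
  by apply/measurable_EFinP; exact: measurable_normal_pdf.
have mpdfB : measurable_fun B (EFin \o normal_pdf 0 s) by exact: measurable_funTS.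
rewrite ge0_integral_mscale//; last by move=> x _; rewrite lee_fin normal_pdf_ge0.
rewrite ge0_integral_pushforward//; last by move=> x _; rewrite lee_fin normal_pdf_ge0.
have mpre : measurable (dilation s @^-1` B).
  by rewrite -[X in measurable X]setTI; exact: measurable_dilation.
rewrite -ge0_integralZl//=.
- apply: eq_integral => z _; rewrite -EFinM; congr EFin.
  rewrite !normal_pdfE ?oner_neq0 ?gt_eqF//= (normal_peakE s0) !mulrA.
  rewrite mulfV ?gt_eqF// mul1r; congr (_ * expR _).
  rewrite /dilation !subr0; field; rewrite gt_eqF//.
- by apply: measurable_funTS; exact: measurableT_comp mpdf md.
- by move=> x _; rewrite lee_fin normal_pdf_ge0.
- by rewrite lee_fin ltW.
Qed.

(** * Conditional expectations under a centred Gaussian conditional law *)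

Section gaussian_conditional_law.
Context (R : realType) (d : measure_display) (T : measurableType d).
Variables (P : probability T R) (X Y : {RV P >-> R}) (s : R -> R).
Hypothesis ms : measurable_fun [set: R] s.
Hypothesis s0 : forall w, 0 <= s (X w).
Hypothesis XY : is_cond_law P X Y (fun t => gaussian_law 0 (s t)).

Let PX := distribution P X.

Let phi (p : R * R) : R * R := (p.1, Num.sqrt (s p.1) * p.2).

Let psi (w : T) : R * R := (X w, Y w).

Let mphi : measurable_fun [set: R * R] phi.
Proof.
apply/measurable_fun_pairP; split; first exact: measurable_fst.
rewrite (_ : _ \o _ = fun p : R * R => Num.sqrt (s p.1) * p.2)//.
apply: measurable_funM => //; apply: measurableT_comp => //.
  by apply: continuous_measurable_fun; exact: sqrt_continuous.
exact: measurableT_comp.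
Qed.

Let mpsi : measurable_fun [set: T] psi.
Proof. by apply/measurable_fun_pairP; split. Qed.

(** Both sides are finite measures, so they need only agree on rectangles, a generating family
    stable under intersection. There the section of the preimage at a point of A is a dilation
    preimage of B, and it is empty off A. *)
Let joint_lawE (C : set (R * R)) : measurable C ->
  pushforward (PX \x N01)%E phi C = pushforward P psi C.
Proof.
pose G : set (set (R * R)) :=
  [set C | exists A, measurable A /\ exists B, measurable B /\ C = A `*` B].
move=> mC.
apply: (@measure_unique _ _ _ G (fun=> setT) _ _ _ _
   (pushforward_measure (PX \x N01)%E mphi) (pushforward_measure P mpsi)) => //.
- rewrite measurable_prod_measurableType //; congr (<<s _ >>).
  rewrite predeqE; split => [[A mA [B mB <-]]|[A [mA [B [mB ->]]]]].
    by exists A; split => //; exists B.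
  by exists A => //; exists B.
- move=> _ _ [X1 [mX1 [X2 [mX2 ->]]]] [Y1 [mY1 [Y2 [mY2 ->]]]].
  rewrite -setXI; exists (X1 `&` Y1); split; first exact: measurableI.
  by exists (X2 `&` Y2); split => //; exact: measurableI.
- by move=> _; exists setT; split => //; exists setT; split => //; rewrite setXTT.
- by rewrite bigcup_const.
- move=> _ [A [mA [B [mB ->]]]].
  have mAB : measurable (A `*` B) by exact: measurableX.
  have mS : measurable (phi @^-1` (A `*` B)).
    by rewrite -[X in measurable X]setTI; exact: mphi.
  change ((PX \x N01)%E (phi @^-1` (A `*` B)) = P (X @^-1` A `&` Y @^-1` B)).
  rewrite XY// /product_measure1 ge0_integral_distribution//; last first.
    exact: measurable_fun_xsection.
  rewrite [RHS]integral_mkcond; apply: eq_integral => w _ /=.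
  rewrite /patch; case: ifPn => XA.
    rewrite gaussian_law_dilation//; congr (normal_prob _ _ _).
    apply/seteqP; split => z; rewrite /xsection/= inE /phi/=.
      by case.
    by move=> Bz; split => //; exact: set_mem XA.
  rewrite (_ : xsection _ _ = set0) ?measure0//.
  apply/seteqP; split => z //; rewrite /xsection/= inE /phi/= => -[XwA _].
  by move/negP: XA; apply; exact: mem_set.
- move=> _.
  change ((PX \x N01)%E (phi @^-1` setT) < +oo)%E.
  rewrite preimage_setT -setXTT product_measure1E//.
  rewrite [X in (X * _)%E]probability_setT [X in (_ * X)%E]probability_setT.
  by rewrite mule1 ltry.
Qed.

Let joint_integralE (f : R * R -> \bar R) : measurable_fun [set: R * R] f ->
  (forall p, 0 <= f p)%E ->
  (\int[P]_w f (psi w) = \int[PX \x N01]_p f (phi p))%E.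
Proof.
move=> mf f0.
have -> : (\int[P]_w f (psi w) = \int[pushforward_measure P mpsi]_p f p)%E.
  by rewrite ge0_integral_pushforward.
have -> : (\int[PX \x N01]_p f (phi p) =
    \int[pushforward_measure (PX \x N01)%E mphi]_p f p)%E.
  by rewrite ge0_integral_pushforward.
by apply: eq_measure_integral => C mC _; apply/esym; exact: joint_lawE.
Qed.

Let joint_integralT (f : R * R -> \bar R) : measurable_fun [set: R * R] f ->
  (\int[P]_w f (psi w) = \int[PX \x N01]_p f (phi p))%E.
Proof.
move=> mf; rewrite [LHS]integralE [RHS]integralE; congr (_ - _)%E.
  transitivity (\int[P]_w f^\+ (psi w))%E.
    by apply: eq_integral => w _; rewrite !funeposE.
  rewrite (@joint_integralE f^\+%E) //; last exact: measurable_funepos.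
  by apply: eq_integral => p _; rewrite !funeposE.
transitivity (\int[P]_w f^\- (psi w))%E.
  by apply: eq_integral => w _; rewrite !funenegE.
rewrite (@joint_integralE f^\-%E) //; last exact: measurable_funeneg.
by apply: eq_integral => p _; rewrite !funenegE.
Qed.

(** By Fubini, m and the partial integral h of f over z have equal integrals over every Borel set
    under the law of X; hence they agree almost everywhere for that law. *)
Lemma gaussian_cond_expectation (f : R * R -> R) (m : R -> R) :
  measurable_fun [set: R * R] f ->
  is_cond_expectation P X (fun w => f (X w, Y w)) m ->
  {ae P, forall w, m (X w) = \int[N01]_z f (X w, Num.sqrt (s (X w)) * z)}.
Proof.
move=> mf [mm If Im mE].
have mEf : measurable_fun [set: R * R] (EFin \o f) by exact/measurable_EFinP.
pose F (p : R * R) := (f (phi p))%:E.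
have mF : measurable_fun [set: R * R] F by exact: measurableT_comp mEf mphi.
have intF : (PX \x N01)%E.-integrable [set: R * R] F.
  apply/integrableP; split => //.
  rewrite -(@joint_integralE (abse \o (EFin \o f)))//.
  - by case/integrableP : If.
  - exact: measurableT_comp.
  - by move=> p; exact: abse_ge0.
pose h := fubini_F N01 F.
have mh : measurable_fun [set: R] h by exact: measurable_fubini_F intF.
have mEm : measurable_fun [set: R] (EFin \o m) by exact/measurable_EFinP.
have hm : ae_eq PX [set: R] (EFin \o m) h.
  apply: integral_ae_eq => //.
    by apply: integrable_pushforward => //; rewrite preimage_setT.
  move=> E _ measE.
  have mXE : measurable (X @^-1` E) by exact: measurable_funPTI.
  rewrite integral_pushforward//; last exact: integrableS Im.
  rewrite [LHS]mE//.
  (* The event {X in E} is encoded as a restriction on the first coordinate, which [phi] leaves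
     fixed. *)
  pose g (p : R * R) := ((EFin \o f) \_ (fst @^-1` E)) p.
  have mg : measurable_fun [set: R * R] g.
    apply/(measurable_restrictT _ _).1; last exact: measurable_funTS.
    by rewrite -[X in measurable X]setTI; exact: measurable_fst.
  transitivity (\int[P]_w g (psi w))%E.
    rewrite integral_mkcond; apply: eq_integral => w _.
    by rewrite /g /patch /psi/=.
  rewrite joint_integralT// -integral12_prod_meas1; last first.
    apply: le_integrable intF => //; first exact: measurableT_comp mg mphi.
    move=> p _; rewrite /g /patch; case: ifPn => // _.
    by rewrite abse0 abse_ge0.
  rewrite [RHS]integral_mkcond; apply: eq_integral => t _.
  rewrite /fubini_F /g /patch; case: ifPn => tE.
    by apply: eq_integral => z _; rewrite [_ \in _]tE.
  by apply: integral0_eq => z _; rewrite [_ \in _](negbTE tE).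
(* A null set for the law of X pulls back along X to a P-null set. *)
case: hm => A [mA A0 hA]; exists (X @^-1` A); split => //.
  exact: measurable_funPTI.
move=> w /= hw; apply: hA => /= /(_ I) mhE; apply: hw.
exact: (congr1 fine mhE).
Qed.

End gaussian_conditional_law.

(** * Conditional variance of the transformed pixel *)

Theorem proposition1 (R : realType) (abar bbar : R)
    (abar_gt0 : 0 < abar) (bbar_ge0 : 0 <= bbar)
    (delta : R) (delta_gt0 : 0 < delta) :
  exists2 sigma0 : R, 0 < sigma0 &
  forall (d : measure_display) (Omega : measurableType d)
    (P : probability Omega R) (pixel : Type)
    (x n y : pixel -> {RV P >-> R}) (astar bstar : R),
  0 < astar -> 0 <= bstar ->
  (forall i w, 0 <= x i w) ->
  (forall i w, y i w = x i w + n i w) ->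
  (forall i, is_cond_law P (x i) (n i)
               (fun t => gaussian_law 0 (astar * t + bstar))) ->
  forall (i : pixel) (v : R -> R),
  is_cond_variance P (x i) (fun w => gen_anscombe abar bbar (y i w)) v ->
  {ae P, forall w, Num.sqrt (astar * x i w + bstar) <= sigma0 ->
    `| v (x i w) - (astar * x i w + bstar)
                   / (abar * x i w + bbar + 3 / 8 * abar ^+ 2) |
    <= delta * ((astar * x i w + bstar)
                / (abar * x i w + bbar + 3 / 8 * abar ^+ 2))}.
Proof.
have [sigma0 sigma0_gt0 main] :=
  gen_anscombe_gaussian_variance abar_gt0 bbar_ge0 delta_gt0.
exists sigma0 => // d Omega P pixel x n y astar bstar astar0 bstar0 x0 yE law i v.
case=> m condm condv; have [mm _ _ _] := condm.
pose s t := astar * t + bstar.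
have ms : measurable_fun [set: R] s by apply: measurable_funD => //; exact: measurable_funM.
have s0 w : 0 <= s (x i w) by rewrite addr_ge0// mulr_ge0// ltW.
pose f (p : R * R) := gen_anscombe abar bbar (p.1 + p.2).
have mf : measurable_fun [set: R * R] f.
  by apply: measurableT_comp; [exact: measurable_gen_anscombe|exact: measurable_funD].
have ZE w : gen_anscombe abar bbar (y i w) = f (x i w, n i w) by rewrite yE.
have condf : is_cond_expectation P (x i) (fun w => f (x i w, n i w)) m.
  by under eq_fun do rewrite -ZE.
(* The squared deviation is again a measurable function of (x, n), so the same disintegration
   applies a second time, now to v. *)
pose g (p : R * R) := (f p - m p.1) ^+ 2.
have mg : measurable_fun [set: R * R] g.
  apply: measurable_funX; apply: measurable_funB => //.
  exact: measurableT_comp.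
have condg : is_cond_expectation P (x i) (fun w => g (x i w, n i w)) v.
  by move: condv; under eq_fun do rewrite ZE.
have mE := gaussian_cond_expectation ms s0 (law i) mf condf.
have vE := gaussian_cond_expectation ms s0 (law i) mg condg.
apply: filterS2 mE vE => w mE vE sigma0_ge.
(* Inside the integral for v the first coordinate is frozen at [x i w], so m there is the mean given
   by [mE] at the same w, and v is exactly the variance bounded by [main]. *)
by rewrite vE /g /= mE; exact: main.
Qed.
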